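(* Let $N\geq3$ and let $\rho$ be the unique positive real root of $X^N-X^{N-1}-\cdots-X-1$. (1) Let $\mathcal T$ be the inflation–substitution tiling with prototiles $R_j$ of length $\rho^{1-j}$ ($1\leq j\leq N$), initial tile $[0,1]=R_1$ and substitution rules $\rho R_1=R_1|R_2|\cdots|R_N$, $\rho R_j=R_{j-1}$ for $2\leq j\leq N$. Then every $\rho$-integer is an endpoint of some tile of $\mathcal T$ (the tiling of $[0,\infty)$ whose endpoints are the $\rho$-integers is subordinate to $\mathcal T$). (2) Let $\widehat{\mathcal T}$ be the inflation–substitution tiling with prototiles $\widehat R_1,\dots,\widehat R_N$ of lengths $1$ and $\sum_{i=1}^{N-j+1}\rho^{-i}$ for $2\leq j\leq N$ (i.e. $1,\ \frac1\rho+\cdots+\frac1{\rho^{N-1}},\ \dots,\ \frac1\rho$), initial tile $[0,1]=\widehat R_1$, and substitution rules $\rho\widehat R_j=\widehat R_1|\widehat R_{j+1}$ for $1\leq j\leq N-1$, $\rho\widehat R_N=\widehat R_1$. Then $\widehat{\mathcal T}$ is inflationary with multiplier $\rho$, and the set of its endpoints is exactly the set of $\rho$-integers.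
   Context: A non-negative real number is a $\rho$-integer if it equals $\sum_{i=0}^{n}c_i\rho^{n-i}$ for some $n\in\mathbb N_0$ and $c_i\in\{0,1\}$. Inflation–substitution tiling: given prototiles (intervals of given lengths) and for each prototile a finite word in the prototiles (the substitution rule, written $\rho R=\cdots$, whose lengths sum to $\rho$ times the length of $R$) such that the word for the initial prototile begins with that prototile, start with the one-letter word consisting of the initial prototile and repeatedly replace every letter by its word; each word is a prefix of the next, so they converge to an infinite word, and laying intervals of the corresponding lengths consecutively starting at $0$ gives a tiling of $[0,\infty)$, with endpoints the partial sums of lengths. A tiling $\mathcal T'$ is subordinate to $\mathcal T$ if every endpoint of $\mathcal T'$ is an endpoint of $\mathcal T$. A tiling with endpoints $0=y_0<y_1<\cdots$ is inflationary with multiplier $\rho$ if there is a rule assigning to each occurring tile length $\ell$ an ordered list of occurring lengths with sum $\rho\ell$ such that each $[\rho y_{i-1},\rho y_i]$ is exactly the union of consecutive tiles whose lengths in order form the list assigned to $y_i-y_{i-1}$. *)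

(* Defs.v *)
From HB Require Import structures.
From mathcomp Require Import all_boot all_order all_algebra.
From mathcomp Require Import all_classical all_reals.

Set Implicit Arguments.
Unset Strict Implicit.
Unset Printing Implicit Defensive.
Import Order.TTheory GRing.Theory Num.Theory.
Local Open Scope classical_set_scope.
Local Open Scope ring_scope.

Definition nbonacci_poly (R : nzRingType) (N : nat) : {poly R} :=
  'X^N - \sum_(i < N) 'X^i.

Definition rho_integers (R : realType) (rho : R) : set R :=
  [set x | 0 <= x /\ exists (n : nat) (c : 'I_n.+1 -> bool),
     x = \sum_(i < n.+1) (c i)%:R * rho ^+ (n - i)].

(* A tiling of [0, +oo[ is given by its increasing sequence of endpoints. *)
Definition is_tiling (R : realType) (y : nat -> R) : Prop :=
  [/\ y 0%N = 0, forall n, y n < y n.+1 & forall x, exists n, x < y n].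

Definition endpoints (R : realType) (y : nat -> R) : set R := range y.

Definition tile_length (R : realType) (y : nat -> R) (i : nat) : R :=
  y i.+1 - y i.

Definition subordinate (R : realType) (y' y : nat -> R) : Prop :=
  [/\ is_tiling y', is_tiling y & endpoints y' `<=` endpoints y].

Definition inflationary (R : realType) (rho : R) (y : nat -> R) : Prop :=
  is_tiling y /\
  exists rule : R -> seq R, forall i : nat,
    let s := rule (tile_length y i) in
    [/\ forall l, l \in s -> range (tile_length y) l,
        \sum_(l <- s) l = rho * tile_length y i
      & exists k : nat,
          [/\ y k = rho * y i, y (k + size s)%N = rho * y i.+1
            & forall m, (m < size s)%N -> tile_length y (k + m) = nth 0 s m]].

(* [P] selects the labels in [A] that actually name prototiles. *)
Definition inflation_substitution (R : realType) (A : Type) (P : pred A)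
    (rho : R) (len : A -> R) (rule : A -> seq A) (a0 : A) : Prop :=
  [/\ P a0,
      forall a, P a -> 0 < len a,
      forall a, P a -> all P (rule a),
      forall a, P a -> \sum_(b <- rule a) len b = rho * len a
    & exists u, rule a0 = a0 :: u].

Definition substitute (A : Type) (rule : A -> seq A) (w : seq A) : seq A :=
  flatten (map rule w).

Definition inflation_word (A : Type) (rule : A -> seq A) (a0 : A) (k : nat) :
  seq A := iter k (substitute rule) [:: a0].

(* The [n]-th iterate has more than [n] letters, so it already determines the
   [n]-th letter of the limit; see [inflation_word_limit]. *)
Definition limit_word (A : Type) (rule : A -> seq A) (a0 : A) (n : nat) : A :=
  nth a0 (inflation_word rule a0 n) n.

Definition inflation_tiling (R : realType) (A : Type) (len : A -> R)
    (rule : A -> seq A) (a0 : A) (n : nat) : R :=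
  \sum_(i < n) len (limit_word rule a0 i).

(* Prototiles are labelled 1, ..., N; other labels never occur in the words. *)
Definition is_label (N : nat) : pred nat := fun j => (1 <= j <= N)%N.

Definition len_R (R : realType) (rho : R) (j : nat) : R := rho ^- (j - 1).

Definition rule_R (N j : nat) : seq nat :=
  if j == 1%N then iota 1 N else [:: j.-1].

Definition tiling_R (R : realType) (N : nat) (rho : R) : nat -> R :=
  inflation_tiling (len_R rho) (rule_R N) 1%N.

Definition len_hatR (R : realType) (N : nat) (rho : R) (j : nat) : R :=
  if j == 1%N then 1 else \sum_(1 <= i < (N - j + 1).+1) rho ^- i.

Definition rule_hatR (N j : nat) : seq nat :=
  if (j < N)%N then [:: 1%N; j.+1] else [:: 1%N].

Definition tiling_hatR (R : realType) (N : nat) (rho : R) : nat -> R :=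
  inflation_tiling (len_hatR N rho) (rule_hatR N) 1%N.

Lemma substitute_cat (A : Type) (rule : A -> seq A) (v w : seq A) :
  substitute rule (v ++ w) = substitute rule v ++ substitute rule w.
Proof. by rewrite /substitute map_cat flatten_cat. Qed.

Lemma inflation_word_prefix (R : realType) (A : Type) (P : pred A) (rho : R)
    (len : A -> R) (rule : A -> seq A) (a0 : A) :
  1 < rho -> inflation_substitution P rho len rule a0 ->
  forall k, exists v, [/\ (0 < size v)%N, all P v
    & inflation_word rule a0 k.+1 = inflation_word rule a0 k ++ v].
Proof.
move=> rho1 [Pa0 lenP ruleP sumP [u ru]]; elim=> [|k [v [v0 Pv vE]]].
  exists u; split; last by rewrite /inflation_word /= /substitute /= cats0.
    case: u ru (sumP _ Pa0) => // -> /eqP; rewrite big_seq1.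
    by rewrite -subr_eq0 -{1}[len a0]mul1r -mulrBl mulf_eq0 subr_eq0
      (lt_eqF rho1) gt_eqF ?lenP.
  by have := ruleP _ Pa0; rewrite ru /= => /andP[].
exists (substitute rule v); split; last first.
- by rewrite [LHS]/inflation_word iterS -/(inflation_word _ _ k.+1) {1}vE
    substitute_cat -[substitute rule (inflation_word _ _ k)]/(inflation_word _ _ k.+1).
- elim: v {v0 vE} Pv => //= a v IH /andP[Pa /IH Pv].
  by rewrite /substitute /= all_cat ruleP.
case: v v0 Pv {vE} => //= a v _ /andP[Pa _].
rewrite /substitute /= size_cat addn_gt0.
case: (rule a) (sumP _ Pa) => //= /eqP; rewrite big_nil eq_sym mulf_eq0.
by rewrite !gt_eqF ?lenP // (lt_trans ltr01 rho1).
Qed.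

Lemma inflation_word_limit (R : realType) (A : Type) (P : pred A) (rho : R)
    (len : A -> R) (rule : A -> seq A) (a0 : A) :
  1 < rho -> inflation_substitution P rho len rule a0 ->
  forall k, (k < size (inflation_word rule a0 k))%N /\
    inflation_word rule a0 k =
    mkseq (limit_word rule a0) (size (inflation_word rule a0 k)).
Proof.
move=> rho1 infl; set W := inflation_word rule a0.
have step := inflation_word_prefix rho1 infl.
have sz k : (k < size (W k))%N.
  elim: k => // k IH; have [v [v0 _ E]] := step k.
  by rewrite /W E size_cat -addn1 leq_add.
have pre k d : exists v, W (k + d)%N = W k ++ v.
  elim: d => [|d [v vE]]; first by exists [::]; rewrite addn0 cats0.
  have [v' [_ _ E]] := step (k + d)%N; exists (v ++ v').
  by rewrite addnS /W E -/(W _) vE catA.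
move=> k; split=> //; apply: (@eq_from_nth _ a0); first by rewrite size_mkseq.
move=> i ik; rewrite nth_mkseq // /limit_word -/(W i).
have [ki|/ltnW ki] := leqP k i.
  by have [v] := pre k (i - k)%N; rewrite subnKC // => ->; rewrite nth_cat ik.
by have [v] := pre i (k - i)%N; rewrite subnKC // => ->; rewrite nth_cat sz.
Qed.

Lemma root_nbonacciE (R : realType) (N : nat) (x : R) :
  root (nbonacci_poly R N) x = (x ^+ N == \sum_(i < N) x ^+ i).
Proof.
rewrite rootE /nbonacci_poly hornerD hornerN hornerXn horner_sum subr_eq0.
by under eq_bigr do rewrite hornerXn.
Qed.

Lemma nbonacci_root_sum (R : realType) (N : nat) (x : R) :
  0 < x -> root (nbonacci_poly R N) x -> \sum_(1 <= i < N.+1) x ^- i = 1.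
Proof.
move=> x0; rewrite root_nbonacciE => /eqP xN.
have xn0 : x != 0 by rewrite gt_eqF.
apply: (mulfI (expf_neq0 N xn0)); rewrite mulr1 {2}xN mulr_sumr.
rewrite big_nat_rev big_add1 big_mkord; apply: eq_bigr => i _ /=.
have iN : (i <= N)%N := ltnW (ltn_ord i).
by rewrite add1n !subSS -{1}(subnKC iN) exprD mulfK ?expf_neq0.
Qed.

Lemma nbonacci_root_unique (R : realType) (N : nat) (x y : R) :
  (0 < N)%N -> 0 < x -> root (nbonacci_poly R N) x ->
  0 < y -> root (nbonacci_poly R N) y -> x = y.
Proof.
move=> N0; wlog xy : x y / x < y.
  by move=> H; case: (ltgtP x y) => // xy *; [apply: H | symmetry; apply: H].
move=> x0 /(nbonacci_root_sum x0) sx y0 /(nbonacci_root_sum y0) sy.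
suff : \sum_(1 <= i < N.+1) y ^- i < \sum_(1 <= i < N.+1) x ^- i.
  by rewrite sx sy ltxx.
apply: ltr_sum_nat => // i /andP[i0 _].
by rewrite ltf_pV2 ?posrE ?exprn_gt0 // ltrXn2r // -?lt0n // ?i0 ltW.
Qed.

Lemma nbonacci_root_exists (R : realType) (N : nat) :
  (0 < N)%N -> exists2 x : R, 0 < x & root (nbonacci_poly R N) x.
Proof.
move=> N0; have pE (x : R) : (nbonacci_poly R N).[x] = x ^+ N - \sum_(i < N) x ^+ i.
  rewrite /nbonacci_poly hornerD hornerN hornerXn horner_sum.
  by under eq_bigr do rewrite hornerXn.
have sgn : (nbonacci_poly R N).[1] <= 0 <= (nbonacci_poly R N).[2].
  rewrite !pE expr1n; apply/andP; split.
    under eq_bigr do rewrite expr1n.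
    by rewrite sumr_const card_ord subr_le0 ler1n.
  have := subrX1 (2 : R) N; rewrite (_ : 2 - 1 = 1 :> R) ?mul1r => [<-|].
    by rewrite opprB addrC subrK.
  by rewrite mulr2n addrK.
have [|x /andP[x1 _] rx] := poly_ivt _ sgn; first by rewrite ler1n.
by exists x => //; apply: lt_le_trans x1.
Qed.

Lemma nbonacci_root_gt1 (R : realType) (N : nat) (rho : R) :
  (3 <= N)%N -> 0 < rho -> root (nbonacci_poly R N) rho -> 1 < rho.
Proof.
move=> N3 r0 /(nbonacci_root_sum r0) s1; rewrite ltNge; apply/negP => r1.
have ge1 i : 1 <= rho ^- i by rewrite invf_ge1 ?exprn_gt0 // exprn_ile1 // ltW.
have : \sum_(1 <= i < N.+1) (1 : R) <= 1.
  by rewrite -[leRHS]s1; apply: ler_sum_nat => i _.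
by rewrite big_const_nat iter_addr_0 subn1 /= lern1 leqNgt (leq_trans _ N3).
Qed.

Lemma inflation_substitution_R (R : realType) (N : nat) (rho : R) :
  (3 <= N)%N -> 0 < rho -> root (nbonacci_poly R N) rho ->
  inflation_substitution (is_label N) rho (len_R rho) (rule_R N) 1%N.
Proof.
move=> N3 r0 rr; have N0 : (0 < N)%N by apply: leq_trans N3.
have rn0 : rho != 0 by rewrite gt_eqF.
split; rewrite /is_label ?N0 //.
- by move=> j _; rewrite invr_gt0 exprn_gt0.
- move=> j /andP[j1 jN]; rewrite /rule_R; case: eqP => [_|/eqP jn1].
    by apply/allP => i; rewrite mem_iota add1n ltnS.
  by rewrite /= andbT; case: j j1 jN jn1 => [//|[//|j]] _ /ltnW.
- move=> j /andP[j1 jN]; rewrite /rule_R /len_R; case: eqP => [->|/eqP jn1].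
    rewrite subnn expr0 invr1 -(nbonacci_root_sum r0 rr) mulr_sumr.
    rewrite (_ : iota 1 N = index_iota 1 N.+1); last by rewrite /index_iota subn1.
    rewrite !big_nat; apply: eq_bigr => -[//|i] _.
    by rewrite subn1 /= exprS invfM mulrA divff ?mul1r.
  case: j j1 jN jn1 => [//|[//|j]] _ _ _; rewrite big_seq1 !subn1 /=.
  by rewrite exprS invfM mulrA divff ?mul1r.
by exists (iota 2 N.-1); rewrite /rule_R eqxx -[in LHS](prednK N0).
Qed.

Lemma inflation_substitution_hatR (R : realType) (N : nat) (rho : R) :
  (3 <= N)%N -> 0 < rho -> root (nbonacci_poly R N) rho ->
  inflation_substitution (is_label N) rho (len_hatR N rho) (rule_hatR N) 1%N.
Proof.
move=> N3 r0 rr; have N1 : (1 < N)%N by apply: leq_trans N3.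
have rn0 : rho != 0 by rewrite gt_eqF.
have lenE j : is_label N j ->
    len_hatR N rho j = \sum_(1 <= i < (N - j + 1).+1) rho ^- i.
  move=> /andP[j1 jN]; rewrite /len_hatR; case: eqP => [->|//].
  by rewrite subnK ?nbonacci_root_sum // ltnW.
split; rewrite /is_label ?(ltnW N1) //.
- move=> j jP; rewrite lenE // addn1 big_nat_recl //= ltr_pwDl //.
    by rewrite invr_gt0 exprn_gt0.
  by apply: sumr_ge0 => i _; rewrite invr_ge0 exprn_ge0 // ltW.
- move=> j /andP[j1 jN]; rewrite /rule_hatR; case: ltnP => jN' /=.
    by rewrite jN' (ltnW N1).
  by rewrite (ltnW N1).
- move=> j jP; have /andP[j1 jN] := jP.
  rewrite (lenE j) // addn1 big_nat_recl // mulrDr expr1 divff //.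
  rewrite /rule_hatR; case: ltnP => jN'.
    rewrite big_cons big_seq1 (lenE j.+1) /is_label ?jN' // {1}/len_hatR eqxx.
    congr (_ + _); rewrite mulr_sumr subnS addn1 prednK ?subn_gt0 //.
    rewrite !big_add1 /=; apply: eq_bigr => i _.
    by rewrite [rho ^+ i.+2]exprS invfM mulrA divff ?mul1r.
  have -> : j = N by apply/eqP; rewrite eqn_leq jN.
  by rewrite subnn big_geq // mulr0 addr0 big_seq1 /len_hatR eqxx.
by exists [:: 2%N]; rewrite /rule_hatR N1.
Qed.

(* Main.v *)
(* The limit word of an inflation-substitution tiling is fixed by the
   substitution, so multiplication by rho carries the endpoints y_n of the
   tiling to endpoints, and cuts [rho y_n, rho y_(n+1)] according to the rule of
   the n-th tile.  In the second tiling every rule is the unit tile followed by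
   at most one other tile: the endpoints are then exactly the numbers reached
   from 0 by the maps y |-> rho y and y |-> rho y + 1, and by Horner's scheme
   these are the rho-integers.  Finally, cutting R^_1 into R_1 and R^_j into
   R_2 | ... | R_(N-j+2) for j > 1 intertwines the two substitutions, hence maps
   one limit word to the other, so the first tiling refines the second. *)
Require Import Defs.
From mathcomp Require Import all_boot all_order all_algebra.
From mathcomp Require Import all_classical all_reals.

Set Implicit Arguments.
Unset Strict Implicit.
Unset Printing Implicit Defensive.
Import Order.TTheory GRing.Theory Num.Theory.
Local Open Scope classical_set_scope.
Local Open Scope ring_scope.

Lemma exists_factor (A B C : Type) (P : A -> Prop) (f : A -> B) (h : A -> C)
    (c0 : C) :
  (forall a b, P a -> P b -> f a = f b -> h a = h b) ->
  exists g : B -> C, forall a, P a -> g (f a) = h a.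
Proof.
move=> fh.
suff /choice[g gE] y : exists c, forall a, P a -> f a = y -> c = h a.
  by exists g => a Pa; apply: gE.
have [[b Pb <-]|no_preimage] := pselect (exists2 b, P b & f b = y).
  by exists (h b) => a Pa fab; apply: fh.
by exists c0 => a Pa fay; case: no_preimage; exists a.
Qed.

Lemma exprn_unbounded (F : archiRealFieldType) (r x : F) :
  1 < r -> exists n, x < r ^+ n.
Proof.
move=> r_gt1; have r1_gt0 : 0 < r - 1 by rewrite subr_gt0.
exists (Num.truncn (x / (r - 1))).+1; set n := _.+1.
have x_lt : x < (r - 1) * n%:R by rewrite mulrC -ltr_pdivrMr // truncnS_gt.
have bernoulli : (r - 1) * n%:R <= r ^+ n - 1.
  rewrite subrX1 ler_pM2l // -[n in n%:R]card_ord -sumr_const.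
  by apply: ler_sum => i _; rewrite exprn_ege1 // ltW.
by rewrite (lt_le_trans x_lt) // (le_trans bernoulli) // gerBl.
Qed.

Lemma sum_exprVn_inj (F : numFieldType) (r : F) :
  0 < r -> injective (fun n => \sum_(1 <= i < n.+1) r ^- i).
Proof.
move=> r_gt0; apply/inc_inj/Order.NatMonotonyTheory.incnP => n.
by rewrite [ltRHS]big_nat_recr //= ltrDl invr_gt0 exprn_gt0.
Qed.

Section RhoIntegers.
Variables (R : realType) (rho : R).

Lemma horner_digit_sum (n : nat) (c : 'I_n.+2 -> bool) :
  \sum_(i < n.+2) (c i)%:R * rho ^+ (n.+1 - i) =
  rho * (\sum_(i < n.+1) (c (widen_ord (leqnSn n.+1) i))%:R * rho ^+ (n - i))
  + (c ord_max)%:R.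
Proof.
rewrite big_ord_recr /= subnn expr0 mulr1 mulr_sumr; congr (_ + _).
by apply: eq_bigr => i _; rewrite subSn -1?ltnS // exprS mulrCA.
Qed.

Lemma rho_integers0 : rho_integers rho 0.
Proof.
split=> //; exists 0%N, (fun=> false).
by rewrite big1 // => i _; rewrite mul0r.
Qed.

Lemma rho_integers_horner (x : R) (b : bool) :
  0 <= rho -> rho_integers rho x -> rho_integers rho (rho * x + b%:R).
Proof.
move=> rho_ge0 [x_ge0 [n [c xE]]]; split; first by rewrite addr_ge0 ?mulr_ge0.
exists n.+1, (fun i => if unlift ord_max i is Some j then c j else b).
rewrite horner_digit_sum unlift_none xE; congr (_ * _ + _).
apply: eq_bigr => i _; suff -> : widen_ord (leqnSn n.+1) i = lift ord_max i.
  by rewrite liftK.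
by apply: val_inj; rewrite /= /bump leqNgt ltn_ord.
Qed.

Lemma rho_integers_ind (E : set R) :
  E 0 -> (forall x (b : bool), E x -> E (rho * x + b%:R)) ->
  rho_integers rho `<=` E.
Proof.
move=> E0 E_horner _ [_ [n [c ->]]]; elim: n c => [|n IH] c.
  by have := E_horner 0 (c ord0) E0; rewrite mulr0 add0r big_ord1 mulr1.
by rewrite horner_digit_sum; apply/E_horner/IH.
Qed.

End RhoIntegers.

Definition dissect (A B : Type) (f : A -> seq B) (w : seq A) : seq B :=
  flatten (map f w).

Lemma dissect_cat (A B : Type) (f : A -> seq B) (v w : seq A) :
  dissect f (v ++ w) = dissect f v ++ dissect f w.
Proof. by rewrite /dissect map_cat flatten_cat. Qed.

Lemma dissect_substitute (A B : Type) (P : pred A) (rule : A -> seq A)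
    (rule' : B -> seq B) (f : A -> seq B) (w : seq A) :
  (forall a, P a -> dissect f (rule a) = substitute rule' (f a)) -> all P w ->
  dissect f (substitute rule w) = substitute rule' (dissect f w).
Proof.
move=> f_rule; elim: w => //= a w IH /andP[Pa Pw].
by rewrite /substitute /= dissect_cat f_rule // IH // -substitute_cat.
Qed.

Lemma sum_dissect (R : pzSemiRingType) (A B : Type) (P : pred A)
    (f : A -> seq B) (len : A -> R) (len' : B -> R) (c : R) (w : seq A) :
  (forall a, P a -> \sum_(b <- f a) len' b = c * len a) -> all P w ->
  \sum_(b <- dissect f w) len' b = c * \sum_(a <- w) len a.
Proof.
move=> sum_f; elim: w => [|a w IH] /=; first by rewrite !big_nil mulr0.
by move=> /andP[Pa Pw]; rewrite big_cat big_cons /= sum_f // IH // mulrDr.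
Qed.

Section LimitPrefix.
Variables (A : Type) (rule : A -> seq A) (a0 : A).

Definition limit_prefix (n : nat) : seq A := mkseq (limit_word rule a0) n.

Lemma limit_prefixS (n : nat) :
  limit_prefix n.+1 = rcons (limit_prefix n) (limit_word rule a0 n).
Proof. exact: mkseqS. Qed.

Lemma take_limit_prefix (m n : nat) :
  (m <= n)%N -> take m (limit_prefix n) = limit_prefix m.
Proof.
by move=> mn; rewrite /limit_prefix /mkseq -map_take take_iota (minn_idPl mn).
Qed.

Lemma inflation_tilingE (R : realType) (len : A -> R) (n : nat) :
  inflation_tiling len rule a0 n = \sum_(a <- limit_prefix n) len a.
Proof. by rewrite big_map -val_enum_ord big_map big_enum. Qed.

Lemma tile_length_inflation (R : realType) (len : A -> R) (n : nat) :
  tile_length (inflation_tiling len rule a0) n = len (limit_word rule a0 n).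
Proof.
rewrite /tile_length /inflation_tiling big_ord_recr /=.
by rewrite [_ + len _]addrC addrK.
Qed.

Definition inflated_index (n : nat) : nat :=
  size (substitute rule (limit_prefix n)).

Lemma substitute_limit_prefixS (n : nat) :
  substitute rule (limit_prefix n.+1) =
  substitute rule (limit_prefix n) ++ rule (limit_word rule a0 n).
Proof. by rewrite limit_prefixS -cats1 substitute_cat /substitute /= cats0. Qed.

Lemma inflated_indexS (n : nat) :
  inflated_index n.+1 =
  (inflated_index n + size (rule (limit_word rule a0 n)))%N.
Proof. by rewrite /inflated_index substitute_limit_prefixS size_cat. Qed.

End LimitPrefix.

Section InflationTiling.
Variables (R : realType) (A : Type) (P : pred A) (rho : R) (len : A -> R).
Variables (rule : A -> seq A) (a0 : A).
Hypothesis rho_gt1 : 1 < rho.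
Hypothesis infl : inflation_substitution P rho len rule a0.

Local Notation letter := (limit_word rule a0).
Local Notation prefix := (limit_prefix rule a0).
Local Notation tiling := (inflation_tiling len rule a0).
Local Notation inflated := (inflated_index rule a0).

Lemma size_rule_gt0 (a : A) : P a -> (0 < size (rule a))%N.
Proof.
case: infl => _ len_gt0 _ sum_rule _ Pa.
case: (rule a) (sum_rule a Pa) => //= /eqP; rewrite big_nil eq_sym mulf_eq0.
by rewrite !gt_eqF ?len_gt0 // (lt_trans ltr01).
Qed.

Lemma size_rule_seed_gt1 : (1 < size (rule a0))%N.
Proof.
case: infl => Pa0 len_gt0 _ sum_rule [u rule_a0].
case: u rule_a0 (sum_rule _ Pa0) => [|b u] -> //; rewrite big_seq1 => /eqP.
by rewrite -{1}[len a0]mul1r (inj_eq (mulIf _)) ?(lt_eqF rho_gt1) //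
  gt_eqF ?len_gt0.
Qed.

Lemma all_inflation_word (k : nat) : all P (inflation_word rule a0 k).
Proof.
elim: k => [|k IH]; first by case: infl => Pa0 *; rewrite /= Pa0.
have [v [_ Pv ->]] := inflation_word_prefix rho_gt1 infl k.
by rewrite all_cat IH.
Qed.

Lemma inflation_wordE (k : nat) :
  inflation_word rule a0 k = prefix (size (inflation_word rule a0 k)).
Proof. by have [] := inflation_word_limit rho_gt1 infl k. Qed.

Lemma inflation_word_prefixP (k : nat) (v w : seq A) :
  inflation_word rule a0 k = v ++ w -> v = prefix (size v).
Proof.
move=> W_cat; have := congr1 (take (size v)) (inflation_wordE k).
by rewrite W_cat take_size_cat // take_limit_prefix // size_cat leq_addr.
Qed.

Lemma inflation_word_cat_prefix (n : nat) :
  exists w, inflation_word rule a0 n = prefix n ++ w.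
Proof.
have [n_lt _] := inflation_word_limit rho_gt1 infl n.
exists (drop n (inflation_word rule a0 n)).
by rewrite -(take_limit_prefix _ _ (ltnW n_lt)) -inflation_wordE cat_take_drop.
Qed.

Lemma all_limit_prefix (n : nat) : all P (prefix n).
Proof.
have [w W_cat] := inflation_word_cat_prefix n.
by have := all_inflation_word n; rewrite W_cat all_cat => /andP[].
Qed.

Lemma limit_word_label (n : nat) : P (letter n).
Proof.
by have := all_limit_prefix n.+1; rewrite limit_prefixS all_rcons => /andP[].
Qed.

Lemma substitute_limit_prefix (n : nat) :
  substitute rule (prefix n) = prefix (inflated n).
Proof.
have [w W_cat] := inflation_word_cat_prefix n.
apply: (@inflation_word_prefixP n.+1 _ (substitute rule w)).
by rewrite -substitute_cat -W_cat.
Qed.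

Lemma limit_prefix_inflated (n m : nat) :
  (m <= size (rule (letter n)))%N ->
  prefix (inflated n + m) = prefix (inflated n) ++ take m (rule (letter n)).
Proof.
move=> m_le; rewrite -(@take_limit_prefix _ _ _ _ (inflated n.+1)).
  rewrite -!substitute_limit_prefix substitute_limit_prefixS.
  by rewrite take_cat ltnNge leq_addr /= addKn.
by rewrite inflated_indexS leq_add2l.
Qed.

Lemma limit_word_inflated (n m : nat) :
  (m < size (rule (letter n)))%N ->
  letter (inflated n + m) = nth a0 (rule (letter n)) m.
Proof.
move=> m_lt; have := limit_prefix_inflated m_lt; rewrite addnS limit_prefixS.
by rewrite (limit_prefix_inflated (ltnW m_lt)) (take_nth a0 m_lt) -rcons_cat
  => /rcons_inj[].
Qed.

Lemma inflation_tiling_inflated (n m : nat) :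
  (m <= size (rule (letter n)))%N ->
  tiling (inflated n + m) =
  rho * tiling n + \sum_(a <- take m (rule (letter n))) len a.
Proof.
move=> m_le; rewrite !inflation_tilingE limit_prefix_inflated // big_cat /=.
rewrite -substitute_limit_prefix; have [_ _ _ sum_rule _] := infl.
by congr (_ + _); apply: sum_dissect sum_rule (all_limit_prefix n).
Qed.

Lemma inflation_tiling_inflated0 (n : nat) :
  tiling (inflated n) = rho * tiling n.
Proof.
by rewrite -[inflated n]addn0 inflation_tiling_inflated // take0 big_nil addr0.
Qed.

Lemma tile_length_inflated (n m : nat) :
  (m < size (rule (letter n)))%N ->
  tile_length tiling (inflated n + m) = nth 0 (map len (rule (letter n))) m.
Proof.
move=> m_lt.
by rewrite tile_length_inflation (nth_map a0) // limit_word_inflated.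
Qed.

Lemma inflated_index_gt (n : nat) : (0 < n)%N -> (n < inflated n)%N.
Proof.
elim: n => // -[_ _|n IH _]; rewrite inflated_indexS.
  exact: size_rule_seed_gt1.
by rewrite -addn1 leq_add ?IH // size_rule_gt0 // limit_word_label.
Qed.

Lemma inflated_index_split (n : nat) :
  exists i m, [/\ (m < size (rule (letter i)))%N, n = (inflated i + m)%N
                & (0 < n)%N -> (i < n)%N].
Proof.
suff [i [m [m_lt nE]]] :
    exists i m, (m < size (rule (letter i)))%N /\ n = (inflated i + m)%N.
  exists i, m; split=> //; case: (posnP i) => [-> //|i_gt0 _].
  by rewrite nE (leq_trans (inflated_index_gt i_gt0)) ?leq_addr.
elim: n => [|n [i [m [m_lt ->]]]].
  by exists 0%N, 0%N; rewrite size_rule_gt0 // limit_word_label.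
have [Sm_lt|Sm_ge] := ltnP m.+1 (size (rule (letter i))).
  by exists i, m.+1; rewrite addnS.
exists i.+1, 0%N; rewrite size_rule_gt0 ?limit_word_label // inflated_indexS.
by rewrite -(@anti_leq m.+1 (size (rule (letter i)))) ?m_lt // addn0 addnS.
Qed.

Lemma sum_inflation_word (k : nat) :
  \sum_(a <- inflation_word rule a0 k) len a = rho ^+ k * len a0.
Proof.
have [_ _ _ sum_rule _] := infl.
elim: k => [|k IH]; first by rewrite big_seq1 expr0 mul1r.
by rewrite exprS -mulrA -IH; apply: sum_dissect sum_rule (all_inflation_word k).
Qed.

Lemma inflation_tiling_is_tiling : is_tiling tiling.
Proof.
have [Pa0 len_gt0 _ _ _] := infl; split.
- by rewrite /inflation_tiling big_ord0.
- move=> n; rewrite -subr_gt0 -/(tile_length _ n) tile_length_inflation.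
  exact/len_gt0/limit_word_label.
move=> x; have [k x_lt] := exprn_unbounded (x / len a0) rho_gt1.
exists (size (inflation_word rule a0 k)); rewrite inflation_tilingE.
by rewrite -inflation_wordE sum_inflation_word -ltr_pdivrMr ?len_gt0.
Qed.

Lemma inflation_tiling_inflationary :
  (forall a b, P a -> P b -> len a = len b ->
     map len (rule a) = map len (rule b)) ->
  inflationary rho tiling.
Proof.
move=> rule_len; split; first exact: inflation_tiling_is_tiling.
have [len_rule len_ruleE] := exists_factor [::] rule_len.
exists len_rule => i /=; rewrite tile_length_inflation.
rewrite len_ruleE; last exact: limit_word_label.
split; last exists (inflated i); rewrite ?size_map.
- move=> l /(nthP 0)[m]; rewrite size_map => m_lt <-.
  by exists (inflated i + m)%N => //; rewrite tile_length_inflated.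
- by rewrite big_map; case: infl => _ _ _ -> //; apply: limit_word_label.
split.
- exact: inflation_tiling_inflated0.
- by rewrite -inflated_indexS inflation_tiling_inflated0.
- exact: tile_length_inflated.
Qed.

Lemma endpoints_binary_inflation :
  len a0 = 1 ->
  (forall a, P a -> exists2 u, rule a = a0 :: u & (size u <= 1)%N) ->
  endpoints tiling = rho_integers rho.
Proof.
move=> len_a0 rule_bin.
have rho_ge0 : 0 <= rho by rewrite ltW // (lt_trans ltr01).
have tiling_horner n (b : bool) :
    tiling (inflated n + b) = rho * tiling n + b%:R.
  have [u rule_n _] := rule_bin _ (limit_word_label n).
  rewrite inflation_tiling_inflated rule_n; last by case: b.
  by case: b; rewrite /= ?take0 ?big_seq1 ?big_nil ?len_a0.
have [tiling0 _ _] := inflation_tiling_is_tiling.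
apply/seteqP; split; last first.
  apply: rho_integers_ind; first by exists 0%N.
  by move=> _ b [n _ <-]; exists (inflated n + b)%N.
move=> _ [n _ <-]; elim/ltn_ind: n => -[_|n IH].
  by rewrite tiling0; apply: rho_integers0.
have [i [m [m_lt nE /(_ isT)/IH tiling_i]]] := inflated_index_split n.+1.
have [u rule_i u_le1] := rule_bin _ (limit_word_label i).
have mE : m = (m == 1%N).
  move: m_lt; rewrite rule_i ltnS => /leq_trans/(_ u_le1).
  by case: m {nE} => [|[]].
by rewrite nE mE tiling_horner; apply: rho_integers_horner.
Qed.

End InflationTiling.

Lemma dissection_subordinate (R : realType) (A B : Type) (P : pred A)
    (P' : pred B) (rho : R) (len : A -> R) (len' : B -> R) (rule : A -> seq A)
    (rule' : B -> seq B) (a0 : A) (b0 : B) (f : A -> seq B) :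
  1 < rho -> inflation_substitution P rho len rule a0 ->
  inflation_substitution P' rho len' rule' b0 ->
  f a0 = [:: b0] ->
  (forall a, P a -> dissect f (rule a) = substitute rule' (f a)) ->
  (forall a, P a -> \sum_(b <- f a) len' b = len a) ->
  subordinate (inflation_tiling len rule a0) (inflation_tiling len' rule' b0).
Proof.
move=> rho_gt1 infl infl' f_a0 f_rule f_len.
split; first exact: inflation_tiling_is_tiling infl.
  exact: inflation_tiling_is_tiling infl'.
have f_word k :
    dissect f (inflation_word rule a0 k) = inflation_word rule' b0 k.
  elim: k => [|k IH]; first by rewrite /dissect /= f_a0.
  rewrite [RHS]iterS -[iter _ _ _]IH.
  exact: dissect_substitute f_rule (all_inflation_word rho_gt1 infl k).
move=> _ [n _ <-]; have [w] := inflation_word_cat_prefix rho_gt1 infl n.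
move/(congr1 (dissect f)); rewrite f_word dissect_cat.
move/(inflation_word_prefixP rho_gt1 infl') => f_prefix.
exists (size (dissect f (limit_prefix rule a0 n))) => //.
rewrite !inflation_tilingE -f_prefix -[RHS]mul1r.
apply: sum_dissect (all_limit_prefix rho_gt1 infl n) => a Pa.
by rewrite mul1r f_len.
Qed.

Lemma len_hatR_label (R : realType) (N : nat) (rho : R) (j : nat) :
  0 < rho -> root (nbonacci_poly R N) rho -> is_label N j ->
  len_hatR N rho j = \sum_(1 <= i < (N - j + 1).+1) rho ^- i.
Proof.
move=> rho_gt0 rho_root /andP[_ jN]; rewrite /len_hatR; case: eqP => [j1|//].
by rewrite j1 in jN *; rewrite subnK // nbonacci_root_sum.
Qed.

Lemma len_hatR_inj (R : realType) (N : nat) (rho : R) :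
  0 < rho -> root (nbonacci_poly R N) rho ->
  {in is_label N &, injective (len_hatR N rho)}.
Proof.
move=> rho_gt0 rho_root a b Pa Pb; rewrite !len_hatR_label //.
move/(sum_exprVn_inj rho_gt0)/addIn/(congr1 (subn N)).
by rewrite !subKn //; [case/andP: Pb | case/andP: Pa].
Qed.

Lemma endpoints_tiling_hatR (R : realType) (N : nat) (rho : R) :
  1 < rho ->
  inflation_substitution (is_label N) rho (len_hatR N rho) (rule_hatR N) 1%N ->
  endpoints (tiling_hatR N rho) = rho_integers rho.
Proof.
move=> rho_gt1 infl.
apply: endpoints_binary_inflation rho_gt1 infl _ _ => // j _.
by rewrite /rule_hatR; case: ifP => _; [exists [:: j.+1] | exists [::]].
Qed.

Definition hatR_pieces (N j : nat) : seq nat :=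
  if j == 1%N then [:: 1%N] else iota 2 (N - j + 1).

Lemma substitute_rule_R_iota (N m n : nat) :
  substitute (rule_R N) (iota m.+2 n) = iota m.+1 n.
Proof. by elim: n m => //= n IH m; rewrite -[in RHS](IH m.+1). Qed.

Lemma dissect_rule_hatR (N j : nat) : (1 < N)%N -> is_label N j ->
  dissect (hatR_pieces N) (rule_hatR N j) =
  substitute (rule_R N) (hatR_pieces N j).
Proof.
move=> N_gt1 /andP[j_ge1 jN]; rewrite {2}/hatR_pieces.
case: eqP => [->|/eqP j_neq1].
  rewrite /rule_hatR N_gt1 /hatR_pieces /dissect /substitute /= !cats0.
  rewrite /rule_R /=.
  by case: N N_gt1 {jN} => [|[|n]] // _; rewrite subn2 addn1.
rewrite substitute_rule_R_iota /rule_hatR; case: ltnP => [j_ltN|N_le].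
  rewrite /dissect /= cats0 /hatR_pieces eqSS gtn_eqF //.
  by rewrite -(subnSK j_ltN) !addn1.
by rewrite (@anti_leq j N) ?jN // subnn.
Qed.

Lemma sum_hatR_pieces (R : realType) (N j : nat) (rho : R) :
  \sum_(i <- hatR_pieces N j) len_R rho i = len_hatR N rho j.
Proof.
rewrite /hatR_pieces /len_hatR; case: eqP => _.
  by rewrite big_seq1 /len_R subnn expr0 invr1.
rewrite (iotaDl 1 1) big_map /index_iota subn1 /=.
by apply: eq_bigr => i _; rewrite /len_R addKn.
Qed.

Theorem theorem4p10 (R : realType) (N : nat) (rho : R)
    (N_ge3 : (3 <= N)%N) (rho_gt0 : 0 < rho)
    (rho_root : root (nbonacci_poly R N) rho) :
  (rho_integers rho `<=` endpoints (tiling_R N rho) /\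
   exists Z : nat -> R,
     endpoints Z = rho_integers rho /\ subordinate Z (tiling_R N rho)) /\
  (inflationary rho (tiling_hatR N rho) /\
   endpoints (tiling_hatR N rho) = rho_integers rho).
Proof.
have rho_gt1 := nbonacci_root_gt1 N_ge3 rho_gt0 rho_root.
have infl := inflation_substitution_R N_ge3 rho_gt0 rho_root.
have infl_hat := inflation_substitution_hatR N_ge3 rho_gt0 rho_root.
have endpoints_hat := endpoints_tiling_hatR rho_gt1 infl_hat.
have sub : subordinate (tiling_hatR N rho) (tiling_R N rho).
  apply: (dissection_subordinate (f := hatR_pieces N) rho_gt1 infl_hat infl)
    => // j Pj; last exact: sum_hatR_pieces.
  by apply: dissect_rule_hatR Pj; apply: leq_trans N_ge3.
split; split=> //; first by rewrite -endpoints_hat; case: sub.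
  by exists (tiling_hatR N rho).
apply: inflation_tiling_inflationary rho_gt1 infl_hat _ => i j Pi Pj len_ij.
by rewrite (len_hatR_inj rho_gt0 rho_root Pi Pj len_ij).
Qed.
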